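(* Let $a>0$, $g\in\mathbb R$, and consider the integrable Hamiltonian system on $M^4_{a,g}$ with Hamiltonian $$H=\frac12\Bigl(S_1^2+S_2^2+\frac{S_3^2}\beta\Bigr)+g_1(\mathbf R^2,R_3)(S_1R_2-S_2R_1)+g_2(\mathbf R^2,R_3)\langle\mathbf S,\mathbf R\rangle+g_3(\mathbf R^2,R_3)S_3+V(\mathbf R^2,R_3)$$ and integral $K=S_3$. Let $y\in M^4_{a,g}$ be a singular point of rank $1$, and let $k=S_3(y)$, $x=R_3(y)$ (for such a point $x^2<a$). Then $y$ is non-degenerate if and only if $\frac{\partial^2W_{a,g}(k,x)}{\partial x^2}\ne0$, where $$W_{a,g}(k,x)=\frac{(g-kx)^2}{2(a-x^2)}+\frac{k^2}{2\beta}-\frac{g_1^2(a,x)}2(a-x^2)+g_2(a,x)g+g_3(a,x)k+V(a,x).$$ Moreover, if $\frac{\partial^2W_{a,g}(k,x)}{\partial x^2}>0$, then the type of the point is elliptic; if $\frac{\partial^2W_{a,g}(k,x)}{\partial x^2}<0$, then the type of the point is hyperbolic.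
   Context: On $\mathrm e(3)^*=\mathbb R^6$ with linear coordinates $(\mathbf S,\mathbf R)=(S_1,S_2,S_3,R_1,R_2,R_3)$ consider the Lie–Poisson bracket $\{S_i,S_j\}=\varepsilon_{ijk}S_k$, $\{S_i,R_j\}=\varepsilon_{ijk}R_k$, $\{R_i,R_j\}=0$. For a smooth function $f$, $\mathrm{sgrad} f$ is the Hamiltonian vector field $\dot x_i=\{x_i,f\}$. For $a>0$, $M^4_{a,g}=\{\langle\mathbf R,\mathbf R\rangle=a,\ \langle\mathbf S,\mathbf R\rangle=g\}$ is a symplectic leaf; $\mathbf R^2=\langle\mathbf R,\mathbf R\rangle$. In the Hamiltonian, $\beta>0$ is a constant and $g_1,g_2,g_3,V$ are smooth functions of two variables $(a,x)$ (the values of $\mathbf R^2$ and $R_3$) in the range $a>0$, $x^2\le a$. A singular point of rank $1$ is a point where the span of $\mathrm{sgrad} H$, $\mathrm{sgrad} K$ is one-dimensional. Non-degeneracy and type of a rank $1$ point $y$: take a non-trivial linear combination $F$ of $H$ and $K$ with $\mathrm{sgrad} F=0$ at $y$, let $A_F$ be the linearization of $\mathrm{sgrad} F$ at $y$ on $T_yM^4_{a,g}$, and let $L$ be the line spanned by $\mathrm{sgrad} H,\mathrm{sgrad} K$ at $y$ and $L^\perp$ its skew-orthogonal complement. The point is non-degenerate iff the operator induced by $A_F$ on the two-dimensional space $L^\perp/L$ has non-zero eigenvalues; it is elliptic if these eigenvalues are purely imaginary ($\pm i\alpha$) and hyperbolic if they are real ($\pm\alpha$). *)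

(* Defs.v *)
From HB Require Import structures.
From mathcomp Require Import all_boot all_order all_algebra.
From mathcomp Require Import complex.
From mathcomp Require Import all_classical all_reals all_analysis.

Set Implicit Arguments.
Unset Strict Implicit.
Unset Printing Implicit Defensive.

Import Order.TTheory GRing.Theory Num.Theory.
Import numFieldNormedType.Exports.

Local Open Scope classical_set_scope.
Local Open Scope ring_scope.

Section Smoothness.
Variables (R : realType) (V : normedModType R).

Fixpoint diff_upto (n : nat) (U : set V) (f : V -> R) : Prop :=
  if n is m.+1 then
    (forall p, U p -> differentiable f p) /\
    (forall v, diff_upto m U (fun p => 'D_v f p))
  else True.

(* Smoothness on a set [D] that need not be open, in the usual sense: [f]
   coincides on [D] with a function that is smooth on an open set containing
   [D].  As [V] is only used in finite dimension, asking that all iterated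
   directional derivatives be Frechet differentiable is the same as asking
   that the function be C^oo. *)
Definition smooth_on (D : set V) (f : V -> R) : Prop :=
  exists (U : set V) (F : V -> R),
    [/\ open U, D `<=` U, {in D, F =1 f} & forall n, diff_upto n U F].

End Smoothness.

Section E3.
Variable R : realType.

(* Points of e(3)^* are row vectors (S, R); the coordinates S_1, S_2, S_3 and
   R_1, R_2, R_3 are indexed by 0, 1, 2 : 'I_3. *)
Local Notation E3 := 'rV[R]_(3 + 3).

Definition Sc (y : E3) (i : 'I_3) : R := y 0 (lshift 3 i).
Definition Rc (y : E3) (i : 'I_3) : R := y 0 (rshift 3 i).

Definition RR (y : E3) : R := \sum_(i < 3) Rc y i ^+ 2.
Definition SR (y : E3) : R := \sum_(i < 3) Sc y i * Rc y i.

Definition leaf (a g : R) : set E3 := [set y | RR y = a /\ SR y = g].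

Definition levi_civita (i j k : 'I_3) : R :=
  (j%:R - i%:R) * (k%:R - i%:R) * (k%:R - j%:R) / 2.

Definition hat (u : 'I_3 -> R) : 'M[R]_3 :=
  \matrix_(i, j) \sum_(k < 3) levi_civita i j k * u k.

(* The matrix of the brackets of the coordinate functions. *)
Definition poisson_mx (y : E3) : 'M[R]_(3 + 3) :=
  block_mx (hat (Sc y)) (hat (Rc y)) (hat (Rc y)) 0.

Definition grad (f : E3 -> R) (y : E3) : 'cV[R]_(3 + 3) :=
  \col_i 'D_(delta_mx 0 i) f y.

Definition bracket (f h : E3 -> R) (y : E3) : R :=
  ((grad f y)^T *m poisson_mx y *m grad h y) 0 0.

Definition sgrad (f : E3 -> R) (y : E3) : E3 :=
  \row_i bracket (fun z : E3 => z 0 i) f y.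

(* Subspaces of R^6 are represented by matrices, through their row spaces. *)
Definition tangent (y : E3) : 'M[R]_(3 + 3) :=
  kermx (row_mx (grad RR y) (grad SR y)).

(* On the tangent space of the leaf (the row space of [(poisson_mx y)^T]) the
   symplectic form is omega (u, v) = u *m symp_mx y *m v^T: if u is the value
   at y of sgrad f, then u *m symp_mx y and the transpose of grad f y have the
   same image by (poisson_mx y)^T, so that omega (u, v) = df(v).  Thus
   omega (sgrad f, sgrad h) = {f, h}. *)
Definition symp_mx (y : E3) : 'M[R]_(3 + 3) := pinvmx (poisson_mx y)^T.

Definition skew_orth (y : E3) m (L : 'M[R]_(m, 3 + 3)) : 'M[R]_(3 + 3) :=
  (tangent y :&: kermx (L *m symp_mx y)^T)%MS.

(* The matrix of the operator induced on U / L by A, for subspaces L <= U that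
   are stable under v |-> v *m A: the operator is read on a complement of L
   in U, by projecting parallel to L, in a basis of that complement. *)
Definition quot_mx n (U L A : 'M[R]_n) : 'M[R]_(\rank (U :\: L)%MS) :=
  row_base (U :\: L)%MS *m A *m proj_mx (U :\: L)%MS L
    *m pinvmx (row_base (U :\: L)%MS).

Definition ceigenvalue n (A : 'M[R]_n) (l : R[i]) : bool :=
  eigenvalue (map_mx (real_complex R) A) l.

Definition orbit_span (H K : E3 -> R) (y : E3) : 'M[R]_(3 + 3) :=
  (sgrad H y + sgrad K y)%MS.

Definition singular_rank1 (H K : E3 -> R) (y : E3) : Prop :=
  \rank (orbit_span H K y) = 1%N.

(* [jacobian] acts on row vectors: v *m jacobian X y is the derivative of X
   at y along v. *)
Definition induced_mx (H K F : E3 -> R) (y : E3) :=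
  let L := orbit_span H K y in
  quot_mx (skew_orth y L) L (jacobian (sgrad F) y).

Definition vanishing_comb (H K F : E3 -> R) (y : E3) : Prop :=
  exists p q : R,
    [/\ (p, q) != (0, 0), F = (fun z => p * H z + q * K z) & sgrad F y = 0].

Definition nondegenerate_point (H K : E3 -> R) (y : E3) : Prop :=
  exists2 F, vanishing_comb H K F y &
    forall l, ceigenvalue (induced_mx H K F y) l -> l != 0.

Definition elliptic_point (H K : E3 -> R) (y : E3) : Prop :=
  exists2 F, vanishing_comb H K F y &
    exists2 alpha : R, alpha != 0 &
      forall l, ceigenvalue (induced_mx H K F y) l <->
        l = (0 +i* alpha)%C \/ l = (0 +i* - alpha)%C.

Definition hyperbolic_point (H K : E3 -> R) (y : E3) : Prop :=
  exists2 F, vanishing_comb H K F y &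
    exists2 alpha : R, alpha != 0 &
      forall l, ceigenvalue (induced_mx H K F y) l <->
        l = (alpha +i* 0)%C \/ l = (- alpha +i* 0)%C.

Definition coef_dom : set (R * R) := [set p | 0 < p.1 /\ p.2 ^+ 2 <= p.1].

Definition Ham (beta : R) (g1 g2 g3 V : R * R -> R) (y : E3) : R :=
  (Sc y 0 ^+ 2 + Sc y 1 ^+ 2 + Sc y 2 ^+ 2 / beta) / 2
  + g1 (RR y, Rc y 2) * (Sc y 0 * Rc y 1 - Sc y 1 * Rc y 0)
  + g2 (RR y, Rc y 2) * SR y
  + g3 (RR y, Rc y 2) * Sc y 2
  + V (RR y, Rc y 2).

Definition Kint (y : E3) : R := Sc y 2.

Definition W (beta : R) (g1 g2 g3 V : R * R -> R) (a g k x : R) : R :=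
  (g - k * x) ^+ 2 / (2 * (a - x ^+ 2))
  + k ^+ 2 / (2 * beta)
  - g1 (a, x) ^+ 2 / 2 * (a - x ^+ 2)
  + g2 (a, x) * g + g3 (a, x) * k + V (a, x).

End E3.

Arguments coef_dom R : clear implicits.
Arguments Kint R : clear implicits.

(* Main.v *)
(* Where R^2 > x^2 the identity (S_1^2 + S_2^2) rho = (<S,R> - K x)^2 + J^2, with
   rho = R^2 - x^2 and J = S_1 R_2 - S_2 R_1, turns H into a function h of the
   Casimirs and of K, x, J, so that sgrad H = gam X_K + xi X_x + eta X_J with
   gam, xi, eta the derivatives of h in K, x, J.  At a point of rank 1 the fields
   X_K, X_x, X_J are independent, hence xi = eta = 0 there: J takes the value
   - rho g_1 where h is critical, at which h becomes W.  The linearization of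
   sgrad (p H + q K) only involves the differentials of the coefficients, which
   vanish at the point.  On L^perp / L, with coordinates dx and rho d eta, it is
   antidiagonal with entries p and - p rho W'', so that its eigenvalues satisfy
   l^2 = - p^2 rho W''. *)
Require Import Defs.
From HB Require Import structures.
From mathcomp Require Import all_boot all_order all_algebra.
From mathcomp Require Import complex ring.
From mathcomp Require Import all_classical all_reals all_analysis.

Set Implicit Arguments.
Unset Strict Implicit.
Unset Printing Implicit Defensive.

Import Order.TTheory GRing.Theory Num.Theory.
Import numFieldNormedType.Exports.
Local Open Scope classical_set_scope.
Local Open Scope ring_scope.

(** * Coordinates on e(3)^* and the Poisson tensor as a pair of cross products *)

Section E3Coordinates.
Variable R : realType.
Local Notation E3 := 'rV[R]_(3 + 3).
Implicit Types (y z u v w : E3).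

Definition mkE3 (s0 s1 s2 r0 r1 r2 : R) : E3 :=
  \row_i [:: s0; s1; s2; r0; r1; r2]`_i.

Lemma ord3P (P : 'I_3 -> Prop) : P 0 -> P 1 -> P 2 -> forall i, P i.
Proof.
move=> P0 P1 P2 [[|[|[|//]]] lti3].
- by have -> : Ordinal lti3 = 0 by apply: val_inj.
- by have -> : Ordinal lti3 = 1 by apply: val_inj.
- by have -> : Ordinal lti3 = 2 by apply: val_inj.
Qed.

Lemma Sc_mkE3 s0 s1 s2 r0 r1 r2 (u := mkE3 s0 s1 s2 r0 r1 r2) :
  (Sc u 0 = s0) * (Sc u 1 = s1) * (Sc u 2 = s2).
Proof. by rewrite /Sc !mxE. Qed.

Lemma Rc_mkE3 s0 s1 s2 r0 r1 r2 (u := mkE3 s0 s1 s2 r0 r1 r2) :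
  (Rc u 0 = r0) * (Rc u 1 = r1) * (Rc u 2 = r2).
Proof. by rewrite /Rc !mxE. Qed.

Lemma E3P u v :
  [/\ Sc u 0 = Sc v 0, Sc u 1 = Sc v 1 & Sc u 2 = Sc v 2] ->
  [/\ Rc u 0 = Rc v 0, Rc u 1 = Rc v 1 & Rc u 2 = Rc v 2] -> u = v.
Proof.
move=> [s0 s1 s2] [r0 r1 r2]; apply/rowP => i.
rewrite -(splitK i); case: (fintype.split i) => j; rewrite /unsplit /=.
  by elim/ord3P: j.
by elim/ord3P: j.
Qed.

Lemma ScD u v i : Sc (u + v) i = Sc u i + Sc v i. Proof. exact: mxE. Qed.
Lemma RcD u v i : Rc (u + v) i = Rc u i + Rc v i. Proof. exact: mxE. Qed.
Lemma ScZ c u i : Sc (c *: u) i = c * Sc u i. Proof. exact: mxE. Qed.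
Lemma RcZ c u i : Rc (c *: u) i = c * Rc u i. Proof. exact: mxE. Qed.
Lemma Sc0 i : Sc (0 : E3) i = 0. Proof. exact: mxE. Qed.
Lemma Rc0 i : Rc (0 : E3) i = 0. Proof. exact: mxE. Qed.

Definition scE := (ScD, RcD, ScZ, RcZ, Sc0, Rc0, Sc_mkE3, Rc_mkE3).

Lemma sum3E (M : nmodType) (f : 'I_3 -> M) : \sum_i f i = f 0 + f 1 + f 2.
Proof.
rewrite !big_ord_recl big_ord0 addr0 -addrA; congr (_ + (f _ + f _)); exact: val_inj.
Qed.

Lemma RRE z : RR z = Rc z 0 ^+ 2 + Rc z 1 ^+ 2 + Rc z 2 ^+ 2.
Proof. exact: sum3E. Qed.

Lemma SRE z : SR z = Sc z 0 * Rc z 0 + Sc z 1 * Rc z 1 + Sc z 2 * Rc z 2.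
Proof. exact: sum3E. Qed.

Definition dot v u : R := (v *m u^T) 0 0.

Lemma dotE v u : dot v u =
  Sc v 0 * Sc u 0 + Sc v 1 * Sc u 1 + Sc v 2 * Sc u 2 +
  (Rc v 0 * Rc u 0 + Rc v 1 * Rc u 1 + Rc v 2 * Rc u 2).
Proof.
rewrite /dot mxE big_split_ord /= !sum3E /Sc /Rc; by rewrite !mxE.
Qed.

Lemma dotDr v u w : dot v (u + w) = dot v u + dot v w.
Proof. by rewrite /dot linearD mulmxDr mxE. Qed.

Lemma dotZr c v u : dot v (c *: u) = c * dot v u.
Proof. by rewrite /dot linearZ -scalemxAr mxE. Qed.

Lemma dotDl v u w : dot (u + w) v = dot u v + dot w v.
Proof. by rewrite /dot mulmxDl mxE. Qed.

Lemma dotZl c v u : dot (c *: v) u = c * dot v u.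
Proof. by rewrite /dot -scalemxAl mxE. Qed.

Lemma dot_delta u i : dot (delta_mx 0 i) u = u 0 i.
Proof. by rewrite /dot -rowE !mxE. Qed.

(* The Hamiltonian vector at [z] of a function whose differential at [z] is
   [dot^~ u]. *)
Definition hvf z u : E3 := u *m (poisson_mx z)^T.

Lemma hvfD z u v : hvf z (u + v) = hvf z u + hvf z v.
Proof. exact: mulmxDl. Qed.

Lemma hvfZ z c u : hvf z (c *: u) = c *: hvf z u.
Proof. by rewrite /hvf scalemxAl. Qed.

Lemma levi_civitaE i j k : levi_civita R i j k =
  if [|| (i, j, k) == (0, 1, 2), (i, j, k) == (1, 2, 0) | (i, j, k) == (2, 0, 1)]
  then 1 else
  if [|| (i, j, k) == (0, 2, 1), (i, j, k) == (2, 1, 0) | (i, j, k) == (1, 0, 2)]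
  then -1 else 0.
Proof.
(* The literals [1] and [2] of ['I_3] unfold to these remainders, which have to become numerals
   before [field] can conclude. *)
have [e1 e2] : (1 %% 3 = 1 /\ (1 %% 3 + 1 %% 3) %% 3 = 2)%N by [].
by elim/ord3P: i; elim/ord3P: j; elim/ord3P: k;
  rewrite /levi_civita /= ?e2 ?e1; field.
Qed.

(** The right-hand side is the [i]-th component of the cross product of [w] and [u]. *)
Lemma hatE (u : 'I_3 -> R) i (w : 'I_3 -> R) :
  \sum_j w j * hat u i j =
  if i == 0 then w 1 * u 2 - w 2 * u 1 else
  if i == 1 then w 2 * u 0 - w 0 * u 2 else w 0 * u 1 - w 1 * u 0.
Proof.
by rewrite sum3E !mxE !sum3E !levi_civitaE; elim/ord3P: i; rewrite /=; ring.
Qed.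

(** With [z = (S, R)] and [u = (u_S, u_R)] this is (u_S x S + u_R x R, u_S x R), where x denotes the
    cross product. *)
Lemma hvfE z u : hvf z u = mkE3
  (Sc u 1 * Sc z 2 - Sc u 2 * Sc z 1 + (Rc u 1 * Rc z 2 - Rc u 2 * Rc z 1))
  (Sc u 2 * Sc z 0 - Sc u 0 * Sc z 2 + (Rc u 2 * Rc z 0 - Rc u 0 * Rc z 2))
  (Sc u 0 * Sc z 1 - Sc u 1 * Sc z 0 + (Rc u 0 * Rc z 1 - Rc u 1 * Rc z 0))
  (Sc u 1 * Rc z 2 - Sc u 2 * Rc z 1)
  (Sc u 2 * Rc z 0 - Sc u 0 * Rc z 2)
  (Sc u 0 * Rc z 1 - Sc u 1 * Rc z 0).
Proof.
have HS i : Sc (hvf z u) i =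
    \sum_j Sc u j * hat (Sc z) i j + \sum_j Rc u j * hat (Rc z) i j.
  rewrite /hvf /poisson_mx /Sc mxE big_split_ord /=; congr (_ + _).
    by apply: eq_bigr => j _; rewrite mxE block_mxEul.
  by apply: eq_bigr => j _; rewrite mxE block_mxEur.
have HR i : Rc (hvf z u) i = \sum_j Sc u j * hat (Rc z) i j.
  rewrite /hvf /poisson_mx /Rc mxE big_split_ord /= [X in _ + X]big1.
    by rewrite addr0; apply: eq_bigr => j _; rewrite mxE block_mxEdl.
  by move=> j _; rewrite mxE block_mxEdr !mxE mulr0.
by apply: E3P; split; rewrite ?HS ?HR !hatE scE.
Qed.

End E3Coordinates.

Arguments dot {R} v u.

(** * Differential calculus with explicit differentials *)

Definition pd1 (R : realType) (G : R * R -> R) (p : R * R) : R := 'D_(1, 0) G p.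
Definition pd2 (R : realType) (G : R * R -> R) (p : R * R) : R := 'D_(0, 1) G p.

Section Differentials.
Variables (R : realType) (V : normedModType R).
Implicit Types (f g df dg : V -> R) (x : V).

(** This rule and the next ones are stated for lambda abstractions, the form in which [is_diff_auto]
    meets them when it assembles a differential. *)
Lemma is_diff_cstr (c : R) x : is_diff x (fun=> c) (fun=> 0).
Proof. exact: is_diff_cst. Qed.

Lemma is_diff_add f g df dg x : is_diff x f df -> is_diff x g dg ->
  is_diff x (fun z => f z + g z) (fun v => df v + dg v).
Proof. exact: is_diffD. Qed.

Lemma is_diff_opp f df x : is_diff x f df ->
  is_diff x (fun z => - f z) (fun v => - df v).
Proof. exact: is_diffN. Qed.

Lemma is_diff_mul f g df dg x : is_diff x f df -> is_diff x g dg ->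
  is_diff x (fun z => f z * g z) (fun v => f x * dg v + g x * df v).
Proof. exact: is_diffM. Qed.

Lemma is_diff_exp f df n x : is_diff x f df ->
  is_diff x (fun z => f z ^+ n.+1) (fun v => n.+1%:R * f x ^+ n * df v).
Proof.
move=> fdf; rewrite (_ : (fun z => _) = f ^+ n.+1); last first.
  by apply/funext => z; rewrite exprfctE.
by apply: is_diff_eq (is_diffX _ _) _; apply/funext => v; rewrite /= mulr_natl.
Qed.

Lemma is_diff_inv f df x : f x != 0 -> is_diff x f df ->
  is_diff x (fun z => (f z)^-1) (fun v => - (f x ^- 2) * df v).
Proof.
move=> fx0 fdf; apply: DiffDef; first exact: differentiableV.
by rewrite diffV // diff_val.
Qed.

Lemma is_diff_comp2 (G : R * R -> R) f g df dg x :
  differentiable G (f x, g x) -> is_diff x f df -> is_diff x g dg ->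
  is_diff x (fun z => G (f z, g z))
    (fun v => pd1 G (f x, g x) * df v + pd2 G (f x, g x) * dg v).
Proof.
move=> /differentiableP dG fdf gdg.
apply: is_diff_eq (is_diff_comp (is_diff_pair fdf gdg) dG) _.
apply/funext => v /=; rewrite /pd1 /pd2 !deriveE //.
have -> : (df v, dg v) = df v *: ((1, 0) : R * R) + dg v *: ((0, 1) : R * R).
  by congr (_, _); rewrite /= /GRing.scale /= !mulr1 !mulr0 ?addr0 ?add0r.
by rewrite linearD !linearZ mulrC [X in _ + X]mulrC.
Qed.

Lemma is_diffE f df x v : is_diff x f df -> 'D_v f x = df v.
Proof. by move=> fdf; rewrite deriveE // diff_val. Qed.

(** The difference [g - f] vanishes near [x], so its differential at [x] is zero, and [g] is the sum
    of [f] and this difference. *)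
Lemma near_eq_differentiable (W : normedModType R) (f g : V -> W) x :
  (\near x, f x = g x) -> differentiable f x -> differentiable g x.
Proof.
move=> fg df; have fgx : f x = g x := nbhs_singleton fg.
have d0 : continuous (0 : V -> W) /\
    (g - f) \o shift x = cst ((g - f) x) + 0 +o_ 0 id.
  split; first exact: cst_continuous.
  apply/eqaddoP => _/posnumP[e].
  have : \forall y \near 0, f (y + x) = g (y + x).
    by have := fg; rewrite (near_shift 0) subr0; apply: filterS => ?.
  apply: filterS => y /= fgy.
  by rewrite !fctE /= fgx fgy !subrr addr0 subrr normr0 mulr_ge0.
rewrite (_ : g = f + (g - f)); last by rewrite addrC subrK.
apply: differentiableD => //; apply/diff_locallyP.
by rewrite (@diff_unique _ _ _ _ (\0)) //; case: d0.
Qed.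

Lemma near_eq_is_diff f g df x :
  (\near x, f x = g x) -> is_diff x f df -> is_diff x g df.
Proof.
move=> fg fdf; have dg : differentiable g x.
  by apply: near_eq_differentiable fg _; case: fdf.
apply: DiffDef => //; apply/funext => v.
by rewrite -deriveE // -(near_eq_derive _ fg) deriveE // diff_val.
Qed.

End Differentials.

(** * Jacobians of row-valued maps *)

Section RowDifferentials.
Variables (R : realType) (n : nat).
Local Notation E := 'rV[R]_n.

Lemma differentiable_row (V : normedModType R) (X : V -> E) x :
  (forall i, differentiable (fun z => X z 0 i) x) -> differentiable X x.
Proof.
move=> dX; rewrite (_ : X = \sum_i (fun z => X z 0 i *: delta_mx 0 i)).
  by apply: differentiable_sum => i; apply: differentiableZl.
by apply/funext => z; rewrite fct_sumE {1}[X z]row_sum_delta.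
Qed.

Lemma mulmx_jacobian (X : E -> E) (dX : E -> E) x v :
  (forall i, is_diff x (fun z => X z 0 i) (fun v => dX v 0 i)) ->
  v *m jacobian X x = dX v.
Proof.
move=> diX; have dXx : differentiable X x.
  by apply: differentiable_row => i; case: (diX i).
rewrite -deriveEjacobian // derive_mx; last exact: diff_derivable.
by apply/rowP => i; rewrite mxE (is_diffE v (diX i)).
Qed.

(** By the Leibniz rule the derivative of each [X j] is multiplied by [c j x = 0], so that only the
    differentials of the coefficients survive. This linearizes a Hamiltonian field at one of its
    zeros without differentiating the fields [X j]. *)
Lemma mulmx_jacobian_lincomb (m : nat) (c : 'I_m -> E -> R)
    (dc : 'I_m -> E -> R) (X : 'I_m -> E -> E) (Y : E -> E) x v :
  (\near x, Y x = \sum_j c j x *: X j x) ->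
  (forall j, is_diff x (c j) (dc j)) -> (forall j, c j x = 0) ->
  (forall j i, differentiable (fun z => X j z 0 i) x) ->
  v *m jacobian Y x = \sum_j dc j v *: X j x.
Proof.
move=> YX dcx c0 dX.
apply: (@mulmx_jacobian _ (fun v => \sum_j dc j v *: X j x)) => i.
have sumE (a : 'I_m -> R) (Z : 'I_m -> E) :
    (\sum_j a j *: Z j) 0 i = \sum_j a j * Z j 0 i.
  by rewrite summxE; apply: eq_bigr => j _; rewrite mxE.
have dS : is_diff x (\sum_j (fun z => c j z * X j z 0 i))
                    (\sum_j (fun v => dc j v * X j x 0 i)).
  elim/big_ind2: _ => [|f df g dg ? ?|j _]; first exact: is_diff_cst.
    exact: is_diffD.
  have dXj := differentiableP (dX j i).
  apply: is_diff_eq (is_diff_mul (dcx j) dXj) _.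
  by apply/funext => w; rewrite c0 mul0r add0r mulrC.
have eqY : \near x, (\sum_j (fun z => c j z * X j z 0 i)) x = Y x 0 i.
  by apply: filterS YX => z /= ->; rewrite fct_sumE sumE.
apply: is_diff_eq (near_eq_is_diff eqY dS) _.
by apply/funext => w; rewrite fct_sumE sumE.
Qed.

End RowDifferentials.

(** * Differentials of the basic functions and their Hamiltonian fields *)

Section HamiltonianDifferential.
Variable R : realType.
Local Notation E3 := 'rV[R]_(3 + 3).
Implicit Types (y z u v w : E3).

Definition Jint z : R := Sc z 0 * Rc z 1 - Sc z 1 * Rc z 0.

(* [dot^~ (cov? z)] is the differential at [z] of [?]; [T] stands for
   (S_1^2 + S_2^2) / 2. *)
Definition covK : E3 := mkE3 0 0 1 0 0 0.
Definition covx : E3 := mkE3 0 0 0 0 0 1.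
Definition covJ z : E3 :=
  mkE3 (Rc z 1) (- Rc z 0) 0 (- Sc z 1) (Sc z 0) 0.
Definition covT z : E3 := mkE3 (Sc z 0) (Sc z 1) 0 0 0 0.
Definition covRR z : E3 :=
  mkE3 0 0 0 (2 * Rc z 0) (2 * Rc z 1) (2 * Rc z 2).
Definition covSR z : E3 :=
  mkE3 (Rc z 0) (Rc z 1) (Rc z 2) (Sc z 0) (Sc z 1) (Sc z 2).

Lemma is_diff_coord n (z : 'rV[R]_n) i :
  is_diff z (fun z : 'rV[R]_n => z 0 i) (fun v : 'rV[R]_n => v 0 i).
Proof.
apply: DiffDef; first exact: differentiable_coord.
apply/funext => v.
have lin : linear (fun z : 'rV[R]_n => z 0 i : R).
  by move=> c u w; rewrite !mxE.
pose f : {linear 'rV[R]_n -> R} := HB.pack (fun z : 'rV[R]_n => z 0 i : R)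
  (GRing.isLinear.Build _ _ _ _ _ lin).
by rewrite -[LHS]/('d f z v) diff_lin //; exact: coord_continuous.
Qed.

Lemma is_diff_Sc z i : is_diff z (fun z => Sc z i) (fun v => Sc v i).
Proof. exact: is_diff_coord. Qed.

Lemma is_diff_Rc z i : is_diff z (fun z => Rc z i) (fun v => Rc v i).
Proof. exact: is_diff_coord. Qed.

Lemma is_diff_RR z : is_diff z (@RR R) (dot^~ (covRR z)).
Proof.
rewrite (_ : @RR R = fun z => Rc z 0 ^+ 2 + Rc z 1 ^+ 2 + Rc z 2 ^+ 2);
  last by apply/funext => ?; rewrite RRE.
have d i : is_diff z (fun z => Rc z i ^+ 2) (fun v => 2 * Rc z i ^+ 1 * Rc v i).
  exact/is_diff_exp/is_diff_Rc.
apply: is_diff_eq (is_diff_add (is_diff_add (d 0) (d 1)) (d 2)) _.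
by apply/funext => v; rewrite dotE !scE; ring.
Qed.

Lemma is_diff_SR z : is_diff z (@SR R) (dot^~ (covSR z)).
Proof.
rewrite (_ : @SR R = fun z => Sc z 0 * Rc z 0 + Sc z 1 * Rc z 1 + Sc z 2 * Rc z 2);
  last by apply/funext => ?; rewrite SRE.
have d i := is_diff_mul (is_diff_Sc z i) (is_diff_Rc z i).
apply: is_diff_eq (is_diff_add (is_diff_add (d 0) (d 1)) (d 2)) _.
by apply/funext => v; rewrite dotE !scE; ring.
Qed.

Lemma is_diff_Jint z : is_diff z Jint (dot^~ (covJ z)).
Proof.
have d i j := is_diff_mul (is_diff_Sc z i) (is_diff_Rc z j).
apply: is_diff_eq (is_diff_add (d 0 1) (is_diff_opp (d 1 0))) _.
by apply/funext => v; rewrite dotE !scE; ring.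
Qed.

Lemma is_diff_Kint z : is_diff z (Kint R) (dot^~ covK).
Proof.
apply: is_diff_eq (is_diff_Sc z 2) _.
by apply/funext => v; rewrite dotE !scE; ring.
Qed.

Lemma is_diff_x z : is_diff z (fun z => Rc z 2) (dot^~ covx).
Proof.
apply: is_diff_eq (is_diff_Rc z 2) _.
by apply/funext => v; rewrite dotE !scE; ring.
Qed.

Lemma gradE (f : E3 -> R) z u : is_diff z f (dot^~ u) -> grad f z = u^T.
Proof.
by move=> dfu; apply/colP => i; rewrite !mxE (is_diffE _ dfu) dot_delta.
Qed.

(** The gradient of the [i]-th coordinate is [delta_mx i 0], so bracketing it with [f] extracts the
    [i]-th entry of [poisson_mx z *m grad f z], whose transpose is [hvf z u]. *)
Lemma sgradE (f : E3 -> R) z u : is_diff z f (dot^~ u) -> sgrad f z = hvf z u.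
Proof.
move=> /gradE/(congr1 trmx); rewrite trmxK => <-.
have gradc i : grad (fun z : E3 => z 0 i) z = delta_mx i 0.
  apply/colP => j; rewrite !mxE (is_diffE _ (is_diff_coord z i)) !mxE eqxx.
  by rewrite andbT eq_sym.
rewrite /hvf -trmx_mul; apply/rowP => i.
by rewrite !mxE /bracket gradc trmx_delta -rowE -row_mul !mxE.
Qed.

End HamiltonianDifferential.

(** The differential is usually an existential variable that the rules fill in;
    [notypeclasses refine] keeps instance search from choosing another form of it. Nonvanishing of
    denominators and differentiability of the coefficients are left as side goals. *)
Ltac is_diff_auto := repeat first
  [ exact: is_diff_cstr | exact: is_diff_RR | exact: is_diff_SR
  | exact: is_diff_Jint | exact: is_diff_Kint | exact: is_diff_x
  | exact: is_diff_Sc | exact: is_diff_Rc | exact: is_diff_id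
  | notypeclasses refine (is_diff_add _ _)
  | notypeclasses refine (is_diff_opp _)
  | notypeclasses refine (is_diff_mul _ _)
  | notypeclasses refine (is_diff_inv _ _)
  | notypeclasses refine (is_diff_exp _ _)
  | notypeclasses refine (is_diff_comp2 _ _ _) ].

Lemma lincomb3D (R : pzRingType) (M : lmodType R) (a b c k x j : R) (A B C T : M) :
  T = a *: A + b *: B + c *: C ->
  T + k *: A + x *: B + j *: C = (k + a) *: A + (x + b) *: B + (j + c) *: C.
Proof.
move=> eT; rewrite !scalerDl (addrACA (k *: A)) [RHS]addrACA -eT [RHS]addrC.
by rewrite -!addrA.
Qed.

(** * The field of H in terms of the fields of K, x and J *)

Section Hamiltonian.
Variables (R : realType) (beta : R) (g1 g2 g3 V : R * R -> R).
Local Notation E3 := 'rV[R]_(3 + 3).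
Implicit Types (y z u v w : E3).

(** The regularity that the linearization of [sgrad H] and the second derivative of [W] call for. It
    makes sense at boundary points of [coef_dom] because [G] is defined around them. *)
Definition twice_diff (G : R * R -> R) : Prop := forall p, coef_dom R p ->
  [/\ differentiable G p, differentiable (pd1 G) p & differentiable (pd2 G) p].

Hypothesis beta0 : beta != 0.
Hypothesis dg1 : twice_diff g1.
Hypothesis dg2 : twice_diff g2.
Hypothesis dg3 : twice_diff g3.
Hypothesis dV : twice_diff V.

(* [H] is the given Hamiltonian, whose coefficients are smooth only on
   [coef_dom], and the [g_i] and [V] are extensions of these coefficients. *)
Variable H : E3 -> R.
Hypothesis HE : forall z, 0 < RR z -> Ham beta g1 g2 g3 V z = H z.

Definition base z : R * R := (RR z, Rc z 2).

Lemma sqr_le_RR z : Rc z 2 ^+ 2 <= RR z.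
Proof. by rewrite RRE lerDr addr_ge0 // sqr_ge0. Qed.

Lemma coef_dom_base z : 0 < RR z -> coef_dom R (base z).
Proof. by move=> ?; split => //; exact: sqr_le_RR. Qed.

Definition coefRR z : R :=
  Jint z * pd1 g1 (base z) + SR z * pd1 g2 (base z) + Kint R z * pd1 g3 (base z)
  + pd1 V (base z).

Definition coefx z : R :=
  Jint z * pd2 g1 (base z) + SR z * pd2 g2 (base z) + Kint R z * pd2 g3 (base z)
  + pd2 V (base z).

Lemma near_RR_gt0 z : 0 < RR z -> \forall z' \near z, 0 < RR z'.
Proof.
move=> RRz; have : {for z, continuous (@RR R)}.
  by apply: differentiable_continuous; case: (is_diff_RR z).
by move/(_ _ (lt_nbhsr RRz)).
Qed.

Lemma is_diff_H z : 0 < RR z -> is_diff z H (dot^~ (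
  covT z + (Kint R z / beta + g3 (base z)) *: covK R + coefx z *: covx R
  + g1 (base z) *: covJ z + coefRR z *: covRR z + g2 (base z) *: covSR z)).
Proof.
move=> RRz; apply: (@near_eq_is_diff _ _ (Ham beta g1 g2 g3 V)).
  by apply: filterS (near_RR_gt0 RRz); exact: HE.
have zD := coef_dom_base RRz.
have [[d1 _ _] [d2 _ _] [d3 _ _] [d4 _ _]] :=
  And4 (dg1 zD) (dg2 zD) (dg3 zD) (dV zD).
have -> : Ham beta g1 g2 g3 V = fun z =>
  (Sc z 0 ^+ 2 + Sc z 1 ^+ 2 + Kint R z ^+ 2 / beta) / 2
  + g1 (RR z, Rc z 2) * Jint z + g2 (RR z, Rc z 2) * SR z
  + g3 (RR z, Rc z 2) * Kint R z + V (RR z, Rc z 2) by [].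
eapply is_diff_eq; first by is_diff_auto.
apply/funext => v; rewrite !dotDr !dotZr /coefx /coefRR /base.
rewrite (_ : dot v (covT z) = Sc z 0 * Sc v 0 + Sc z 1 * Sc v 1); last first.
  by rewrite dotE !scE; ring.
by field.
Qed.

(** [RR] is a Casimir function, and so is [SR] in the next lemma. *)
Lemma hvf_covRR z : hvf z (covRR z) = 0.
Proof. by rewrite hvfE; apply: E3P; rewrite !scE; split; ring. Qed.

Lemma hvf_covSR z : hvf z (covSR z) = 0.
Proof. by rewrite hvfE; apply: E3P; rewrite !scE; split; ring. Qed.

Lemma sgrad_Kint z : sgrad (Kint R) z = hvf z (covK R).
Proof. exact/sgradE/is_diff_Kint. Qed.

Lemma sgrad_H z : 0 < RR z -> sgrad H z =
  hvf z (covT z) + (Kint R z / beta + g3 (base z)) *: hvf z (covK R)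
  + coefx z *: hvf z (covx R) + g1 (base z) *: hvf z (covJ z).
Proof.
move=> /is_diff_H/sgradE ->.
by rewrite !hvfD !hvfZ hvf_covRR hvf_covSR !scaler0 !addr0.
Qed.

Definition rho z : R := RR z - Rc z 2 ^+ 2.

(* [gam], [xi] and [eta] are the partial derivatives in K, x and J of H written
   as a function of R^2, <S,R>, K, x and J. *)
Definition gam z : R := Kint R z / beta + g3 (base z)
  - Rc z 2 * (SR z - Kint R z * Rc z 2) / rho z.

Definition xi z : R := coefx z
  + Rc z 2 * ((SR z - Kint R z * Rc z 2) ^+ 2 + Jint z ^+ 2) / rho z ^+ 2
  - Kint R z * (SR z - Kint R z * Rc z 2) / rho z.

Definition eta z : R := g1 (base z) + Jint z / rho z.

Lemma rhoE z : rho z = Rc z 0 ^+ 2 + Rc z 1 ^+ 2.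
Proof. by rewrite /rho RRE addrK. Qed.

Lemma sgrad_H_reduced z : 0 < RR z -> rho z != 0 -> sgrad H z =
  gam z *: hvf z (covK R) + xi z *: hvf z (covx R) + eta z *: hvf z (covJ z).
Proof.
move=> /sgrad_H -> rho0.
(* Up to Casimir differentials, [covT z] is the differential of ((SR - K x)^2 + J^2) / (2 rho); the
   coefficients are its partial derivatives in K, x and J, with [RR] and [SR] fixed. *)
have eT : hvf z (covT z) =
  (- (Rc z 2 * (SR z - Kint R z * Rc z 2) / rho z)) *: hvf z (covK R)
  + (Rc z 2 * ((SR z - Kint R z * Rc z 2) ^+ 2 + Jint z ^+ 2) / rho z ^+ 2
     - Kint R z * (SR z - Kint R z * Rc z 2) / rho z) *: hvf z (covx R)
  + (Jint z / rho z) *: hvf z (covJ z).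
  move: rho0; rewrite rhoE /Jint /Kint SRE !hvfE => rho0.
  by apply: E3P; rewrite !scE; split; field.
by rewrite (lincomb3D _ _ _ eT) /gam /xi /eta addrA.
Qed.

Section Differentials.
Variable y : E3.
Hypothesis RR0 : 0 < RR y.
Hypothesis rho0 : rho y != 0.

(* [xi_x] and [eta_x] are partial derivatives in the same variables; [eta_x] is
   also the derivative of [xi] in J. *)
Definition xi_x : R := Jint y * pd2 (pd2 g1) (base y) + SR y * pd2 (pd2 g2) (base y)
  + Kint R y * pd2 (pd2 g3) (base y) + pd2 (pd2 V) (base y)
  + ((SR y - Kint R y * Rc y 2) ^+ 2 + Jint y ^+ 2) / rho y ^+ 2
  - 2 * Rc y 2 * Kint R y * (SR y - Kint R y * Rc y 2) / rho y ^+ 2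
  + 4 * Rc y 2 ^+ 2 * ((SR y - Kint R y * Rc y 2) ^+ 2 + Jint y ^+ 2) / rho y ^+ 3
  + Kint R y ^+ 2 / rho y
  - 2 * Rc y 2 * Kint R y * (SR y - Kint R y * Rc y 2) / rho y ^+ 2.

Definition eta_x : R := pd2 g1 (base y) + 2 * Rc y 2 * Jint y / rho y ^+ 2.

Lemma is_diff_rho :
  is_diff y rho (fun v => dot v (covRR y) - 2 * Rc y 2 * dot v (covx R)).
Proof.
rewrite /rho; eapply is_diff_eq; first by is_diff_auto.
apply/funext => v; ring.
Qed.

(** The value of the differential is immaterial: it only enters along X_K, which spans L and
    disappears in the quotient L^perp / L. *)
Lemma is_diff_gam : exists D, is_diff y gam D.
Proof.
have [d3 _ _] := dg3 (coef_dom_base RR0).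
have drho := is_diff_rho.
rewrite /gam /base; eexists.
by repeat first [exact: drho | progress is_diff_auto].
Qed.

Lemma is_diff_eta v : dot v (covRR y) = 0 -> 
  exists2 D, is_diff y eta D & D v = eta_x * dot v (covx R) + dot v (covJ y) / rho y.
Proof.
move=> v0.
have [d1 _ _] := dg1 (coef_dom_base RR0).
have drho := is_diff_rho.
eexists.
  rewrite /eta /base; by repeat first [exact: drho | progress is_diff_auto].
rewrite /eta_x /base /= v0; field. by [].
Qed.

(** The three conditions on [v] describe L^perp at a rank 1 point. They remove the derivatives in
    [RR], [SR] and K, leaving those in x and J. *)
Lemma is_diff_xi v : 
  dot v (covRR y) = 0 -> dot v (covSR y) = 0 -> dot v (covK R) = 0 ->
  exists2 D, is_diff y xi D & D v = xi_x * dot v (covx R) + eta_x * dot v (covJ y).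
Proof.
move=> v0 v1 v2.
have [[d1 _ p1] [d2 _ p2] [d3 _ p3] [d4 _ p4]] := And4 (dg1 (coef_dom_base RR0))
  (dg2 (coef_dom_base RR0)) (dg3 (coef_dom_base RR0)) (dV (coef_dom_base RR0)).
have drho := is_diff_rho.
eexists.
  rewrite /xi /coefx /base.
  by repeat first [exact: drho | progress is_diff_auto | exact: expf_neq0].
rewrite /xi_x /eta_x /base /= v0 v1 v2.
(* All quantities become independent variables, so that [field] faces a plain identity of rational
   functions. *)
move: rho0 (SR y) (Kint R y) (Jint y) (dot v (covx R)) (dot v (covJ y)).
move: (rho y) => r r0 s k j dx dJ.
move: (pd2 (pd2 g1) _) (pd2 (pd2 g2) _) (pd2 (pd2 g3) _) (pd2 (pd2 V) _) => h1 h2 h3 h4.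
move: (pd1 (pd2 g1) _) (pd1 (pd2 g2) _) (pd1 (pd2 g3) _) (pd1 (pd2 V) _) => q1 q2 q3 q4.
move: (pd2 g1 _) (pd2 g2 _) (pd2 g3 _) => l1 l2 l3; move: (Rc y 2) => x.
by field.
Qed.

End Differentials.

End Hamiltonian.

(** * Derivatives of the reduced potential *)

Section ReducedPotential.
Variables (R : realType) (beta : R) (g1 g2 g3 V : R * R -> R).
Hypothesis dg1 : twice_diff g1.
Hypothesis dg2 : twice_diff g2.
Hypothesis dg3 : twice_diff g3.
Hypothesis dV : twice_diff V.
Variables (a g k : R).
Hypothesis a0 : 0 < a.
(** [W0] stands for the potential of the given coefficients, while [g1], ..., [V] are their
    extensions. The two potentials need only agree on the open set t^2 < a, which determines the
    derivatives there. *)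
Variable W0 : R -> R.
Hypothesis WE : forall t, t ^+ 2 < a -> W beta g1 g2 g3 V a g k t = W0 t.

Lemma near_sqr_lt t : t ^+ 2 < a -> \forall s \near t, s ^+ 2 < a.
Proof.
have : (fun s : R => s ^+ 2) @ t --> t ^+ 2 by exact: exprn_continuous.
by move=> + ta => /(_ _ (lt_nbhsl ta)).
Qed.

Lemma derive1_W t : t ^+ 2 < a -> (W0^`())%classic t =
  - k * (g - k * t) / (a - t ^+ 2) + t * (g - k * t) ^+ 2 / (a - t ^+ 2) ^+ 2
  - g1 (a, t) * pd2 g1 (a, t) * (a - t ^+ 2) + t * g1 (a, t) ^+ 2
  + pd2 g2 (a, t) * g + pd2 g3 (a, t) * k + pd2 V (a, t).
Proof.
move=> ta; have r0 : a - t ^+ 2 != 0 by rewrite subr_eq0 gt_eqF.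
have tD : coef_dom R (a, t) by split => //; exact: ltW.
have [[d1 _ _] [d2 _ _] [d3 _ _] [d4 _ _]] :=
  And4 (dg1 tD) (dg2 tD) (dg3 tD) (dV tD).
have [D dW DE] : exists2 D, is_diff t (W beta g1 g2 g3 V a g k) D & D 1 =
  - k * (g - k * t) / (a - t ^+ 2) + t * (g - k * t) ^+ 2 / (a - t ^+ 2) ^+ 2
  - g1 (a, t) * pd2 g1 (a, t) * (a - t ^+ 2) + t * g1 (a, t) ^+ 2
  + pd2 g2 (a, t) * g + pd2 g3 (a, t) * k + pd2 V (a, t).
  eexists.
    rewrite /W.
    by repeat first [progress is_diff_auto | exact: mulf_neq0].
  move: r0; rewrite /=.
  move: (pd1 g1 _) (pd1 g2 _) (pd1 g3 _) (pd1 V _) => q1 q2 q3 q4.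
  move: (pd2 g1 _) (pd2 g2 _) (pd2 g3 _) (pd2 V _) (g1 _) => p1 p2 p3 p4 h1 r0.
  by field.
rewrite derive1E -DE; apply: is_diffE; apply: near_eq_is_diff dW.
by apply: filterS (near_sqr_lt ta); exact: WE.
Qed.

Lemma derive2_W x (r := a - x ^+ 2) : x ^+ 2 < a ->
  (W0^`(2))%classic x =
  k ^+ 2 / r - 4 * k * x * (g - k * x) / r ^+ 2 + (g - k * x) ^+ 2 / r ^+ 2
  + 4 * x ^+ 2 * (g - k * x) ^+ 2 / r ^+ 3
  - pd2 g1 (a, x) ^+ 2 * r - g1 (a, x) * pd2 (pd2 g1) (a, x) * r
  + 4 * x * g1 (a, x) * pd2 g1 (a, x) + g1 (a, x) ^+ 2
  + pd2 (pd2 g2) (a, x) * g + pd2 (pd2 g3) (a, x) * k + pd2 (pd2 V) (a, x).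
Proof.
move=> xa; have r0 : a - x ^+ 2 != 0 by rewrite subr_eq0 gt_eqF.
have xD : coef_dom R (a, x) by split => //; exact: ltW.
have [[d1 _ p1] [d2 _ p2] [d3 _ p3] [d4 _ p4]] :=
  And4 (dg1 xD) (dg2 xD) (dg3 xD) (dV xD).
rewrite derive1nS derive1n1 derive1E.
set RHS := (X in _ = X).
suff [D dW DE] : exists2 D, is_diff x (fun t =>
  - k * (g - k * t) / (a - t ^+ 2) + t * (g - k * t) ^+ 2 / (a - t ^+ 2) ^+ 2
  - g1 (a, t) * pd2 g1 (a, t) * (a - t ^+ 2) + t * g1 (a, t) ^+ 2
  + pd2 g2 (a, t) * g + pd2 g3 (a, t) * k + pd2 V (a, t)) D & D 1 = RHS.
  (* The formula of [derive1_W] holds on a neighbourhood of [x], hence may be differentiated in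
     place of the first derivative. *)
  rewrite -DE -(is_diffE _ dW); apply: near_eq_derive.
  by apply: filterS (near_sqr_lt xa) => t; exact: derive1_W.
eexists.
  by repeat first [progress is_diff_auto | exact: expf_neq0].
rewrite {}/RHS /r; move: r0; rewrite /=.
move: (pd1 (pd2 g1) _) (pd1 (pd2 g2) _) (pd1 (pd2 g3) _) (pd1 (pd2 V) _)
  => q1 q2 q3 q4.
move: (pd2 (pd2 g1) _) (pd2 (pd2 g2) _) (pd2 (pd2 g3) _) (pd2 (pd2 V) _)
  => h1 h2 h3 h4.
move: (pd1 g1 _) (pd2 g1 _) (g1 _) => j1 j2 j3 r0.
by field.
Qed.

End ReducedPotential.

(** * Eigenvalues of an operator induced on a quotient *)

Section QuotientEigenvalues.
Variable R : realType.

(** [C] is an isomorphism conjugating [N'] to [N], so it carries eigenvectors to eigenvectors both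
    ways. The sizes are kept distinct because [quot_mx] has size [\rank (U :\: L)], which does not
    reduce to a numeral. *)
Lemma ceigenvalue_intertwined r m (N' : 'M[R]_r) (N : 'M[R]_m) (C : 'M[R]_(r, m)) l :
  row_free C -> row_full C -> N' *m C = C *m N ->
  ceigenvalue N' l = ceigenvalue N l.
Proof.
rewrite /ceigenvalue; set f := real_complex R => freeC fullC eqNC.
have eqfNC : map_mx f N' *m map_mx f C = map_mx f C *m map_mx f N.
  by rewrite -!map_mxM eqNC.
have ffreeC : row_free (map_mx f C) by rewrite row_free_map.
apply/eigenvalueP/eigenvalueP => -[v vN v0].
  exists (v *m map_mx f C); first by rewrite -mulmxA -eqfNC mulmxA vN scalemxAl.
  by rewrite mulmx_free_eq0.
have /submxP[w vw] : (v <= map_mx f C)%MS by rewrite submx_full ?row_full_map.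
exists w; last by apply: contraNneq v0 => w0; rewrite vw w0 mul0mx.
apply: (row_free_inj ffreeC).
by rewrite -mulmxA eqfNC mulmxA -vw vN -scalemxAl -vw.
Qed.

(** [Phi] vanishes on [L] and identifies U / L with the row vectors of length [m], turning the
    induced operator into [N]. Eigenvalues can thus be computed in these coordinates, without
    knowing the complement chosen by [quot_mx]. *)
Lemma ceigenvalue_quot n m (U L A : 'M[R]_n) (Phi : 'M[R]_(n, m)) (N : 'M[R]_m) l :
  (U *m A <= U)%MS -> L *m Phi = 0 ->
  (forall v : 'rV_n, (v <= U)%MS -> v *m Phi = 0 -> (v <= L)%MS) ->
  U *m A *m Phi = U *m Phi *m N -> row_full (U *m Phi) ->
  ceigenvalue (quot_mx U L A) l = ceigenvalue N l.
Proof.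
move=> UA LPhi kerPhi UAPhi fullU; rewrite /quot_mx.
set D := (U :\: L)%MS; set B := row_base D.
have DU : (D <= U)%MS by exact: diffmxSl.
have DL0 : (D :&: L = 0)%MS by exact: capmx_diff.
have UDL : (U <= D + L)%MS.
  by rewrite -(addsmx_diff_cap_eq U L) addsmxS // capmxSr.
have BD : (B :=: D)%MS by exact: eq_row_base.
have BU : (B <= U)%MS by rewrite BD.
have [X BX] := submxP BU.
have BAPhi : B *m A *m Phi = B *m Phi *m N.
  by rewrite BX -!mulmxA; congr (X *m _); rewrite !mulmxA.
apply: (@ceigenvalue_intertwined _ _ _ _ (B *m Phi)).
- apply: inj_row_free => v; rewrite mulmxA => vB0.
  have vBD : (v *m B <= D)%MS by rewrite -BD submxMl.
  have vBL : (v *m B <= L)%MS by apply: kerPhi => //; exact: submx_trans DU.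
  have : (v *m B <= D :&: L)%MS by rewrite sub_capmx vBD.
  rewrite DL0 submx0 => /eqP vB.
  apply: (row_free_inj (row_base_free D)); rewrite mul0mx; exact: vB.
(* [U] lies in [D + L] and [Phi] kills [L], so [D] already has the same image as [U]. *)
- rewrite -sub1mx; apply: submx_trans (_ : U *m Phi <= _)%MS; first by rewrite sub1mx.
  have /sub_addsmxP[[u1 u2] /= ->] := UDL.
  rewrite mulmxDl -[u2 *m L *m Phi]mulmxA LPhi mulmx0 addr0.
  apply: submxMr; apply: submx_trans (submxMl _ _) _; by rewrite BD.
(* Projecting parallel to [L] changes [B *m A] only by rows of [L], which [Phi] does not see. *)
- have BADL : (B *m A <= D + L)%MS.
    by apply: submx_trans UDL; apply: submx_trans UA; exact: submxMr.
  have -> : B *m A *m proj_mx D L *m pinvmx B *m (B *m Phi) =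
            B *m A *m proj_mx D L *m Phi.
    by rewrite mulmxA mulmxKpV // BD proj_mx_sub.
  have /(congr1 (mulmx^~ Phi)) := add_proj_mx DL0 BADL.
  rewrite mulmxDl => e; rewrite -BAPhi -[RHS]e.
  have /submxP[Y ->] := proj_mx_sub L D (B *m A).
  by rewrite -[Y *m L *m Phi]mulmxA LPhi mulmx0 addr0.
Qed.

(** The square of the matrix is the scalar [b * c], which forces the equation on [l]. Conversely
    [(c, l)] is an eigenvector, nonzero thanks to [c != 0]; the case [b = 0], that of a degenerate
    point, is covered. *)
Lemma ceigenvalue_antidiag (b c : R) (l : R[i]) : c != 0 ->
  ceigenvalue (block_mx 0 b%:M c%:M 0 : 'M[R]_(1 + 1)) l <->
  l ^+ 2 = real_complex R (b * c).
Proof.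
move=> c0; rewrite /ceigenvalue map_block_mx !map_mx0 !map_scalar_mx /=.
have fc0 : real_complex R c != 0 by rewrite fmorph_eq0.
rewrite rmorphM /=; split.
  move=> /eigenvalueP[v]; rewrite -[v]hsubmxK mul_row_block scale_row_mx.
  rewrite !mulmx0 add0r addr0 !mul_mx_scalar => /eq_row_mx[e1 e2].
  apply: contraNeq => l2; set v0 := lsubmx v; set v1 := rsubmx v.
  have E (w : 'rV[R[i]]_1) :
      (real_complex R b * real_complex R c) *: w = l ^+ 2 *: w -> w = 0.
    move=> /eqP; rewrite -subr_eq0 -scalerBl scaler_eq0 subr_eq0 eq_sym.
    by rewrite (negPf l2) => /eqP.
  have -> : v0 = 0.
    by apply: E; rewrite mulrC -scalerA e2 scalerA mulrC -scalerA e1 scalerA.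
  have -> : v1 = 0.
    by apply: E; rewrite -scalerA e1 scalerA mulrC -scalerA e2 scalerA.
  by rewrite row_mx0.
move=> l2; apply/eigenvalueP.
exists (row_mx (real_complex R c)%:M l%:M).
  rewrite mul_row_block scale_row_mx !mulmx0 add0r addr0 -!scalar_mxM.
  by rewrite !scale_scalar_mx -[l * l]/(l ^+ 2) l2 [_ * real_complex R b]mulrC.
apply: contra fc0 => /eqP/(congr1 lsubmx); rewrite row_mxKl linear0.
by move=> /matrixP/(_ 0 0); rewrite !mxE mulr1n => ->.
Qed.

End QuotientEigenvalues.

(** * Kernel of the Poisson tensor and skew-orthogonal complements *)

Section SkewOrthogonal.
Variable R : realType.
Local Notation E3 := 'rV[R]_(3 + 3).
Implicit Types (y z u v w : E3).

Lemma mulmx_trE v u : v *m u^T = (dot v u)%:M.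
Proof. by rewrite /dot -mx11_scalar. Qed.

Lemma tangentP y v : reflect (dot v (covRR y) = 0 /\ dot v (covSR y) = 0)
                             (v <= tangent y)%MS.
Proof.
rewrite /tangent (gradE (is_diff_RR y)) (gradE (is_diff_SR y)) sub_kermx.
rewrite mul_mx_row !mulmx_trE; apply: (iffP eqP).
  rewrite -[0]row_mx0 => /eq_row_mx[/matrixP/(_ 0 0) + /matrixP/(_ 0 0)].
  by rewrite !mxE !mulr1n.
by move=> [-> ->]; rewrite raddf0 row_mx0.
Qed.

(** Two vectors with zero cross product are proportional. As the first two components of [r] are not
    both zero, the factor can be read off from them by orthogonal projection in that plane. *)
Lemma cross_eq0 (r0 r1 r2 q0 q1 q2 : R) : r0 ^+ 2 + r1 ^+ 2 != 0 ->
  q1 * r2 - q2 * r1 = 0 -> q2 * r0 - q0 * r2 = 0 -> q0 * r1 - q1 * r0 = 0 ->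
  exists c, [/\ q0 = c * r0, q1 = c * r1 & q2 = c * r2].
Proof.
move=> r_neq0 e0 e1 e2; exists ((q0 * r0 + q1 * r1) / (r0 ^+ 2 + r1 ^+ 2)).
split.
- rewrite -[LHS]subr0 -(mul0r (r1 / (r0 ^+ 2 + r1 ^+ 2))) -e2; by field.
- rewrite -[LHS]addr0 -(mul0r (r0 / (r0 ^+ 2 + r1 ^+ 2))) -e2; by field.
- rewrite -[LHS]subr0 -(mul0r (r0 / (r0 ^+ 2 + r1 ^+ 2))) -e1.
  rewrite -[X in X = _]addr0 -(mul0r (r1 / (r0 ^+ 2 + r1 ^+ 2))) -e0; by field.
Qed.

(** Where [rho] is nonzero the kernel of the Poisson tensor is spanned by the differentials of the
    Casimirs. The R-part of the equation makes the S-part of [w] equal to [c] times R; once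
    [c *: covSR y] is subtracted, the S-part of the equation makes the rest parallel to R. *)
Lemma hvf_eq0 y w : rho y != 0 -> hvf y w = 0 ->
  exists c d, w = c *: covSR y + d *: covRR y.
Proof.
rewrite rhoE => rho0 w0.
have eq0 u : hvf y u = 0 -> [/\
    [/\ Sc u 1 * Sc y 2 - Sc u 2 * Sc y 1 + (Rc u 1 * Rc y 2 - Rc u 2 * Rc y 1) = 0,
        Sc u 2 * Sc y 0 - Sc u 0 * Sc y 2 + (Rc u 2 * Rc y 0 - Rc u 0 * Rc y 2) = 0
      & Sc u 0 * Sc y 1 - Sc u 1 * Sc y 0 + (Rc u 0 * Rc y 1 - Rc u 1 * Rc y 0) = 0],
    Sc u 1 * Rc y 2 - Sc u 2 * Rc y 1 = 0,
    Sc u 2 * Rc y 0 - Sc u 0 * Rc y 2 = 0 &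
    Sc u 0 * Rc y 1 - Sc u 1 * Rc y 0 = 0].
  rewrite hvfE => u0.
  have := (congr1 (fun z => Sc z 0) u0, congr1 (fun z => Sc z 1) u0,
    congr1 (fun z => Sc z 2) u0, congr1 (fun z => Rc z 0) u0,
    congr1 (fun z => Rc z 1) u0, congr1 (fun z => Rc z 2) u0).
  by rewrite !scE => -[[[[[-> ->] ->] ->] ->] ->].
have [_ e0 e1 e2] := eq0 _ w0.
have [c [c0 c1 c2]] := cross_eq0 rho0 e0 e1 e2.
have wc0 : hvf y (w + (- c) *: covSR y) = 0.
  by rewrite hvfD hvfZ w0 hvf_covSR scaler0 addr0.
have [[f0 f1 f2] _ _ _] := eq0 _ wc0.
move: f0 f1 f2; rewrite !scE c0 c1 c2 !mulNr !addrN !mul0r !subr0 !add0r.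
move=> f0 f1 f2.
have [d [d0 d1 d2]] := cross_eq0 rho0 f0 f1 f2.
(* The half compensates the factor 2 in [covRR]. *)
exists c, (d / 2); apply: E3P; rewrite !scE; split.
- by rewrite c0; ring.
- by rewrite c1; ring.
- by rewrite c2; ring.
- by rewrite -[LHS](subrK (c * Sc y 0)) d0; field.
- by rewrite -[LHS](subrK (c * Sc y 1)) d1; field.
- by rewrite -[LHS](subrK (c * Sc y 2)) d2; field.
Qed.

Lemma hvf_skew y u v : dot (hvf y u) v = - dot (hvf y v) u.
Proof. by rewrite !dotE !hvfE !scE; ring. Qed.

(** [hvf y u *m symp_mx y] and [u] have the same Hamiltonian vector, so they differ by Casimir
    differentials, which vanish on tangent vectors. Hence skew-orthogonality of a tangent [v] to the
    line of [hvf y u] amounts to [dot v u = 0]. *)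
Lemma skew_orthP y m (L : 'M[R]_(m, 3 + 3)) u v : rho y != 0 ->
  (L :=: hvf y u)%MS ->
  reflect [/\ dot v (covRR y) = 0, dot v (covSR y) = 0 & dot v u = 0]
          (v <= skew_orth y L)%MS.
Proof.
move=> rho0 Lu; rewrite /skew_orth sub_capmx sub_kermx.
have orthP : (v *m (L *m symp_mx y)^T == 0) = (dot v (hvf y u *m symp_mx y) == 0).
  have /submxP[X LX] : (L <= hvf y u)%MS by rewrite Lu.
  have /submxP[Y uY] : (hvf y u <= L)%MS by rewrite Lu.
  apply/eqP/eqP => e.
    by rewrite /dot uY -mulmxA trmx_mul mulmxA e mul0mx mxE.
  by rewrite LX -mulmxA trmx_mul mulmxA mulmx_trE e raddf0 mul0mx.
have uP : hvf y (hvf y u *m symp_mx y - u) = 0.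
  by rewrite /hvf mulmxBl /symp_mx mulmxKpV ?subrr // submxMl.
have dotE : dot v (covRR y) = 0 -> dot v (covSR y) = 0 ->
    dot v (hvf y u *m symp_mx y) = dot v u.
  move=> v1 v2; have [c [d]] := hvf_eq0 rho0 uP => /(canRL (subrK _)) ->.
  by rewrite !dotDr !dotZr v1 v2 !mulr0 !add0r.
rewrite orthP; apply: (iffP andP) => [[/tangentP[v1 v2]]|[v1 v2 v3]].
  by rewrite dotE // => /eqP.
by split; [exact/tangentP|rewrite dotE // v3].
Qed.

End SkewOrthogonal.

(** * Differentiability of Hamiltonian fields *)

Section DifferentiableHvf.
Variables (R : realType) (y : 'rV[R]_(3 + 3)).
Local Notation E3 := 'rV[R]_(3 + 3).

Lemma differentiable_mulB (f g h k : E3 -> R) :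
  differentiable f y -> differentiable g y ->
  differentiable h y -> differentiable k y ->
  differentiable (fun z => f z * g z - h z * k z) y.
Proof.
move=> df dg dh dk.
exact: differentiableB (differentiableM df dg) (differentiableM dh dk).
Qed.

Lemma differentiable_mkE3 (s0 s1 s2 r0 r1 r2 : E3 -> R) :
  differentiable s0 y -> differentiable s1 y -> differentiable s2 y ->
  differentiable r0 y -> differentiable r1 y -> differentiable r2 y ->
  forall i, differentiable
    (fun z => mkE3 (s0 z) (s1 z) (s2 z) (r0 z) (r1 z) (r2 z) 0 i) y.
Proof.
move=> ds0 ds1 ds2 dr0 dr1 dr2 i.
have E (f g : E3 -> R) : (forall z, f z = g z) -> differentiable g y ->
  differentiable f y by move=> /funext ->.
rewrite -(splitK i); case: (fintype.split i); elim/ord3P.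
- by apply: E ds0 => z; rewrite mxE.
- by apply: E ds1 => z; rewrite mxE.
- by apply: E ds2 => z; rewrite mxE.
- by apply: E dr0 => z; rewrite mxE.
- by apply: E dr1 => z; rewrite mxE.
- by apply: E dr2 => z; rewrite mxE.
Qed.

Lemma differentiable_Sc i : differentiable (fun z : E3 => Sc z i : R) y.
Proof. by case: (is_diff_Sc y i). Qed.

Lemma differentiable_Rc i : differentiable (fun z : E3 => Rc z i : R) y.
Proof. by case: (is_diff_Rc y i). Qed.

Lemma differentiable_hvf (u : E3 -> E3) :
  (forall i, differentiable (fun z => Sc (u z) i) y) ->
  (forall i, differentiable (fun z => Rc (u z) i) y) ->
  forall i, differentiable (fun z => hvf z (u z) 0 i) y.
Proof.
move=> dS dR i; under eq_fun do rewrite hvfE.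
have dSy := differentiable_Sc; have dRy := differentiable_Rc.
have dSB j k l m := differentiable_mulB (dS j) (dSy k) (dS l) (dSy m).
have dRB j k l m := differentiable_mulB (dR j) (dRy k) (dR l) (dRy m).
have dSRB j k l m := differentiable_mulB (dS j) (dRy k) (dS l) (dRy m).
exact: (differentiable_mkE3
  (differentiableD (dSB 1 2 2 1) (dRB 1 2 2 1))
  (differentiableD (dSB 2 0 0 2) (dRB 2 0 0 2))
  (differentiableD (dSB 0 1 1 0) (dRB 0 1 1 0))
  (dSRB 1 2 2 1) (dSRB 2 0 0 2) (dSRB 0 1 1 0) i).
Qed.

End DifferentiableHvf.

(** The equations say that dRR, dSR and dJ vanish on a vector already killed by dK and dx. The
    solutions are the multiples of the rotation field about the third axis, which is X_K. *)
Lemma colinear_rotation (R : fieldType) (s0 s1 r0 r1 S0 S1 R0 R1 : R) :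
  R0 ^+ 2 + R1 ^+ 2 != 0 -> r0 * R0 + r1 * R1 = 0 ->
  s0 * R0 + s1 * R1 + r0 * S0 + r1 * S1 = 0 ->
  s0 * R1 - s1 * R0 - r0 * S1 + r1 * S0 = 0 ->
  exists c, [/\ s0 = - c * S1, s1 = c * S0, r0 = - c * R1 & r1 = c * R0].
Proof.
move=> rho0 e1 e2 e3; set rho := R0 ^+ 2 + R1 ^+ 2 in rho0.
exists ((R0 * r1 - R1 * r0) / rho).
(* Each of the four equalities is a combination of [e1], [e2], [e3] divided by [rho]; [c1], [c2],
   [c3] are the multipliers. *)
have E (a b c1 c2 c3 : R) : a = b + (c1 * (r0 * R0 + r1 * R1)
   + c2 * (s0 * R0 + s1 * R1 + r0 * S0 + r1 * S1)
   + c3 * (s0 * R1 - s1 * R0 - r0 * S1 + r1 * S0)) / rho -> a = b.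
  by rewrite e1 e2 e3 !mulr0 !addr0 mul0r addr0.
split.
- by apply: (E _ _ (- S0) R0 R1); rewrite /rho; field.
- by apply: (E _ _ (- S1) R1 (- R0)); rewrite /rho; field.
- by apply: (E _ _ R0 0 0); rewrite /rho; field.
- by apply: (E _ _ R1 0 0); rewrite /rho; field.
Qed.

(** * Linearization at a critical point and its eigenvalues on L^perp / L *)

Section InducedEigenvalues.
Variables (R : realType) (beta : R) (g1 g2 g3 V : R * R -> R).
Local Notation E3 := 'rV[R]_(3 + 3).
Implicit Types (z u v w : E3).
Hypothesis beta0 : beta != 0.
Hypothesis dg1 : twice_diff g1.
Hypothesis dg2 : twice_diff g2.
Hypothesis dg3 : twice_diff g3.
Hypothesis dV : twice_diff V.
Variable H : E3 -> R.
Hypothesis HE : forall z, 0 < RR z -> Ham beta g1 g2 g3 V z = H z.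
Variable y : E3.
Hypothesis RR0 : 0 < RR y.
Hypothesis rho0 : rho y != 0.
Variables p q : R.
Local Notation F := (fun z => p * H z + q * Kint R z).
Local Notation gam := (gam beta g3).
Local Notation xi := (xi g1 g2 g3 V).
Local Notation eta := (eta g1).
Local Notation xi_x := (xi_x g1 g2 g3 V y).
Local Notation eta_x := (eta_x g1 y).

Lemma sgrad_comb z : 0 < RR z ->
  sgrad F z = p *: sgrad H z + q *: sgrad (Kint R) z.
Proof.
move=> RRz; have [u dH] : exists u, is_diff z H (dot^~ u).
  by eexists; exact: (is_diff_H beta0 dg1 dg2 dg3 dV HE RRz).
have dF : is_diff z F (dot^~ (p *: u + q *: covK R)).
  apply: is_diff_eq (is_diff_add (is_diff_mul (is_diff_cstr p z) dH)
    (is_diff_mul (is_diff_cstr q z) (is_diff_Kint z))) _.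
  by apply/funext => v; rewrite /= !mulr0 !addr0 dotDr !dotZr.
by rewrite (sgradE dF) hvfD !hvfZ (sgradE dH) sgrad_Kint.
Qed.

Hypothesis xi0 : xi y = 0.
Hypothesis eta0 : eta y = 0.
Hypothesis pq0 : p * gam y + q = 0.

Lemma near_rho_neq0 : \forall z \near y, rho z != 0.
Proof.
have : {for y, continuous (@rho R)}.
  by apply: differentiable_continuous; case: (is_diff_rho y).
by move/(_ _ (open_nbhs_nbhs (conj (@open_neq _ 0) rho0))).
Qed.

(** Near [y] the field of [F] is (p gam + q) X_K + p xi X_x + p eta X_J, and the three coefficients
    vanish at [y], so [mulmx_jacobian_lincomb] applies. The coefficient of X_K may stay
    unspecified. *)
Lemma mulmx_jacobian_sgrad v :
  dot v (covRR y) = 0 -> dot v (covSR y) = 0 -> dot v (covK R) = 0 ->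
  exists c, v *m jacobian (sgrad F) y = c *: hvf y (covK R)
    + (p * (xi_x * dot v (covx R) + eta_x * dot v (covJ y))) *: hvf y (covx R)
    + (p * (eta_x * dot v (covx R) + dot v (covJ y) / rho y)) *: hvf y (covJ y).
Proof.
move=> v1 v2 v3.
have [Dg dg] := is_diff_gam beta dg3 RR0 rho0.
have [Dx dx Dxv] := is_diff_xi dg1 dg2 dg3 dV RR0 rho0 v1 v2 v3.
have [De de Dev] := is_diff_eta dg1 RR0 rho0 v1.
pose c (j : 'I_3) : E3 -> R :=
  tnth [tuple (fun z => p * gam z + q); (fun z => p * xi z); (fun z => p * eta z)] j.
pose dc (j : 'I_3) : E3 -> R :=
  tnth [tuple (fun v => p * Dg v); (fun v => p * Dx v); (fun v => p * De v)] j.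
pose X (j : 'I_3) : E3 -> E3 := tnth [tuple (fun z => hvf z (covK R));
  (fun z => hvf z (covx R)); (fun z => hvf z (covJ z))] j.
have eqX : \near y, sgrad F y = \sum_j c j y *: X j y.
  near=> z; have RRz : 0 < RR z by near: z; exact: near_RR_gt0.
  have rhoz : rho z != 0 by near: z; exact: near_rho_neq0.
  rewrite sgrad_comb // (sgrad_H_reduced beta0 dg1 dg2 dg3 dV HE) //.
  rewrite sgrad_Kint sum3E /c /X !(tnth_nth 0) /= !scalerDr !scalerA scalerDl.
  by rewrite -!addrA [q *: _ + _]addrC -!addrA.
have dcc j : is_diff y (c j) (dc j).
  elim/ord3P: j; rewrite /c /dc !(tnth_nth 0) /=.
  - apply: is_diff_eq (is_diff_add (is_diff_mul (is_diff_cstr p y) dg)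
      (is_diff_cstr q y)) _.
    by apply/funext => w /=; rewrite mulr0 !addr0.
  - apply: is_diff_eq (is_diff_mul (is_diff_cstr p y) dx) _.
    by apply/funext => w /=; rewrite mulr0 !addr0.
  - apply: is_diff_eq (is_diff_mul (is_diff_cstr p y) de) _.
    by apply/funext => w /=; rewrite mulr0 !addr0.
have c0 j : c j y = 0.
  by elim/ord3P: j; rewrite /c !(tnth_nth 0) /= ?xi0 ?eta0 ?mulr0.
have dX j i : differentiable (fun z => X j z 0 i) y.
  elim/ord3P: j; rewrite /X !(tnth_nth 0) /=; apply: differentiable_hvf => k //.
  - elim/ord3P: k; under eq_fun do rewrite !scE.
    + exact: differentiable_Rc.
    + exact: differentiableN (differentiable_Rc _ _).
    + exact: differentiable_cst.
  - elim/ord3P: k; under eq_fun do rewrite !scE.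
    + exact: differentiableN (differentiable_Sc _ _).
    + exact: differentiable_Sc.
    + exact: differentiable_cst.
exists (p * Dg v); rewrite -Dxv -Dev.
by rewrite (mulmx_jacobian_lincomb v eqX dcc c0 dX) sum3E /dc /X !(tnth_nth 0).
Unshelve. all: end_near.
Qed.

Hypothesis p0 : p != 0.
Hypothesis XKspan : (orbit_span H (Kint R) y :=: hvf y (covK R))%MS.

Lemma ceigenvalue_induced_mx l :
  ceigenvalue (induced_mx H (Kint R) F y) l <->
  l ^+ 2 = real_complex R (- (p ^+ 2 * rho y * (xi_x - rho y * eta_x ^+ 2))).
Proof.
(* On vectors of L^perp [f2] is rho d eta; compared with dJ, this choice removes the diagonal entry
   of the induced operator. *)
pose f2 : E3 := covJ y + (rho y * eta_x) *: covx R.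
pose Phi : 'M[R]_(3 + 3, 1 + 1) := row_mx (covx R)^T f2^T.
pose b := - (p * rho y * (xi_x - rho y * eta_x ^+ 2)).
pose N : 'M[R]_(1 + 1) := block_mx 0 b%:M p%:M 0.
rewrite /induced_mx; set L := orbit_span H (Kint R) y; set A := jacobian _ y.
set U := skew_orth y L.
have UP (v : E3) := skew_orthP v rho0 XKspan.
have PhiE (v : E3) : v *m Phi = row_mx (dot v (covx R))%:M (dot v f2)%:M.
  by rewrite mul_mx_row !mulmx_trE.
(* x and J are conjugate up to the factor rho. *)
have [e1 e2 e3 e4] : [/\ dot (hvf y (covx R)) (covx R) = 0,
    dot (hvf y (covx R)) (covJ y) = - rho y,
    dot (hvf y (covJ y)) (covx R) = rho y
  & dot (hvf y (covJ y)) (covJ y) = 0].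
  by rewrite rhoE !dotE !hvfE !scE; split; ring.
(* The flow of K rotates about the third axis, which preserves x and J. *)
have [k1 k2] : dot (hvf y (covK R)) (covx R) = 0 /\ dot (hvf y (covK R)) (covJ y) = 0.
  by rewrite !dotE !hvfE !scE; split; ring.
have inU u : dot u (hvf y (covK R)) = 0 -> (hvf y u <= U)%MS.
  move=> u0; apply/UP; split.
  - by rewrite hvf_skew hvf_covRR /dot mul0mx mxE oppr0.
  - by rewrite hvf_skew hvf_covSR /dot mul0mx mxE oppr0.
  - by rewrite hvf_skew /dot -[_ *m _]trmxK trmx_mul trmxK mxE -/(dot _ _) u0 oppr0.
have dotC (u v : E3) : dot u v = dot v u.
  by rewrite /dot -[_ *m _]trmxK trmx_mul trmxK mxE.
have KU : (hvf y (covK R) <= U)%MS.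
  by apply: inU; rewrite dotC dotE !hvfE !scE; ring.
have xU : (hvf y (covx R) <= U)%MS by apply: inU; rewrite dotC.
have JU : (hvf y (covJ y) <= U)%MS by apply: inU; rewrite dotC.
have -> : real_complex R (- (p ^+ 2 * rho y * (xi_x - rho y * eta_x ^+ 2))) =
          real_complex R (b * p) by congr (real_complex R _); rewrite /b; ring.
rewrite -(ceigenvalue_antidiag b l p0) -/N.
rewrite (@ceigenvalue_quot _ _ _ _ _ _ Phi N) //.
- apply/row_subP => i; rewrite row_mul.
  have /UP[v1 v2 v3] : (row i U <= U)%MS by exact: row_sub.
  have [c ->] := mulmx_jacobian_sgrad v1 v2 v3.
  by rewrite !addmx_sub // scalemx_sub.
- have /submxP[D ->] : (L <= hvf y (covK R))%MS by rewrite XKspan.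
  by rewrite -mulmxA PhiE dotDr dotZr k1 k2 mulr0 addr0 raddf0 row_mx0 mulmx0.
(* The kernel of [Phi] in L^perp: such a [v] is killed by dRR, dSR, dK, dx and dJ, hence is a
   multiple of X_K. *)
- move=> v /UP[v1 v2 v3]; rewrite PhiE -[0]row_mx0.
  move=> /eq_row_mx[/matrixP/(_ 0 0) + /matrixP/(_ 0 0)].
  rewrite !mxE !mulr1n dotDr dotZr => v4; rewrite v4 mulr0 addr0 => v5.
  move: v1 v2 v3 v4 v5 (rho0); rewrite !dotE !scE rhoE.
  rewrite !(mulr0, mulr1, addr0, add0r) => v1 v2 v3 v4.
  move=> v5 r0.
  have e1' : Rc v 0 * Rc y 0 + Rc v 1 * Rc y 1 = 0.
    apply: (@mulfI _ 2); first by rewrite pnatr_eq0.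
    by rewrite mulr0 -v1 v4; ring.
  have e2' : Sc v 0 * Rc y 0 + Sc v 1 * Rc y 1 + Rc v 0 * Sc y 0 + Rc v 1 * Sc y 1 = 0.
    by rewrite -v2 v3 v4; ring.
  have e3' : Sc v 0 * Rc y 1 - Sc v 1 * Rc y 0 - Rc v 0 * Sc y 1 + Rc v 1 * Sc y 0 = 0.
    by rewrite -v5; ring.
  have [c [s0 s1 r0' r1']] := colinear_rotation r0 e1' e2' e3'.
  have -> : v = c *: hvf y (covK R).
    by apply: E3P; rewrite hvfE !scE; split;
      rewrite ?v3 ?v4 ?s0 ?s1 ?r0' ?r1'; ring.
  by rewrite scalemx_sub // XKspan.
- apply/row_matrixP => i; rewrite !row_mul.
  have /UP[v1 v2 v3] : (row i U <= U)%MS by exact: row_sub.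
  have [c ->] := mulmx_jacobian_sgrad v1 v2 v3.
  rewrite !PhiE mul_row_block !mulmx0 add0r addr0 -!scalar_mxM.
  rewrite !dotDr !dotDl !dotZr !dotZl e1 e2 e3 e4 k1 k2 /b.
  set P := eta_x; set Q := xi_x; set dx := dot _ (covx R); set dJ := dot _ (covJ y).
  move: rho0; generalize (rho y) => r r0; congr (row_mx _%:M _%:M); field. by []. by [].
rewrite -sub1mx; apply/row_subP => i; move: (row i _) => w.
pose s := w 0 (lshift 1 0); pose t := w 0 (rshift 1 0).
(* The solution of dx(v) = s, f2(v) = t in the span of X_x and X_J, obtained from [e1] to [e4]. *)
pose v := (eta_x * s - t / rho y) *: hvf y (covx R) + (s / rho y) *: hvf y (covJ y).
have -> : w = v *m Phi.
  rewrite PhiE -[w]hsubmxK [lsubmx w]mx11_scalar [rsubmx w]mx11_scalar !mxE -/s -/t.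
  rewrite !dotDr !dotDl !dotZr !dotZl e1 e2 e3 e4.
  generalize (eta_x) => P; move: rho0; generalize (rho y) => r r0.
  congr (row_mx _%:M _%:M); field. by []. by [].
by apply: submxMr; rewrite addmx_sub ?scalemx_sub.
Qed.

End InducedEigenvalues.

(** * Consequences of rank 1 *)

Section RankOne.
Variables (R : realType) (beta : R) (g1 g2 g3 V : R * R -> R).
Local Notation E3 := 'rV[R]_(3 + 3).
Hypothesis beta0 : beta != 0.
Hypothesis dg1 : twice_diff g1.
Hypothesis dg2 : twice_diff g2.
Hypothesis dg3 : twice_diff g3.
Hypothesis dV : twice_diff V.
Variable H : E3 -> R.
Hypothesis HE : forall z, 0 < RR z -> Ham beta g1 g2 g3 V z = H z.
Variable y : E3.
Hypothesis RR0 : 0 < RR y.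
Hypothesis rank1 : singular_rank1 H (Kint R) y.

(** If X_K vanished, S and R would both lie on the third axis; there [sgrad H] vanishes as well, and
    the rank would be 0. *)
Lemma rank1_XK_neq0 : hvf y (covK R) != 0.
Proof.
apply/eqP => XK0; have XKE := XK0.
rewrite hvfE !(scE, mul0r, add0r, addr0, mul1r, sub0r, subr0) in XKE.
have [[/eqP s1 s0] [/eqP r1 r0]] :
    (- Sc y 1 = 0 /\ Sc y 0 = 0) /\ (- Rc y 1 = 0 /\ Rc y 0 = 0).
  have := (congr1 (fun z => Sc z 0) XKE, congr1 (fun z => Sc z 1) XKE,
    congr1 (fun z => Rc z 0) XKE, congr1 (fun z => Rc z 1) XKE).
  by rewrite !scE => -[[[-> ->] ->] ->].
rewrite oppr_eq0 in s1; rewrite oppr_eq0 in r1.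
move: s1 r1 => /eqP s1 /eqP r1.
have H0 : sgrad H y = 0.
  rewrite (sgrad_H beta0 dg1 dg2 dg3 dV HE RR0) XK0 scaler0 addr0.
  rewrite !hvfE; apply: E3P; rewrite !scE s0 s1 r0 r1; split; ring.
have := rank1; rewrite /singular_rank1 /orbit_span sgrad_Kint H0 XK0.
by rewrite addsmx0 mxrank0.
Qed.

Lemma rank1_orbit_span :
  (orbit_span H (Kint R) y :=: hvf y (covK R))%MS.
Proof.
have XKs : (hvf y (covK R) <= orbit_span H (Kint R) y)%MS.
  by rewrite /orbit_span sgrad_Kint addsmxSr.
have := mxrank_leqif_eq XKs; rewrite rank1 rank_rV rank1_XK_neq0 => -[_].
by rewrite eqxx => /esym/eqmxP/eqmx_sym.
Qed.

Lemma rank1_sgrad_H : exists c, sgrad H y = c *: hvf y (covK R).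
Proof.
apply/sub_rVP; rewrite -rank1_orbit_span; exact: addsmxSl.
Qed.

(** If [rho] vanished, R would be a nonzero vector on the third axis. In [sgrad H = c X_K] the
    R-components of X_K, X_x and X_J are then zero, so those of the kinetic term are too; this puts
    S on the axis and gives X_K = 0. *)
Lemma rank1_rho_neq0 : rho y != 0.
Proof.
apply/negP; rewrite rhoE paddr_eq0 ?sqr_ge0 // !sqrf_eq0 => /andP[/eqP r0 /eqP r1].
have r2 : Rc y 2 != 0.
  by apply: contraTneq RR0 => r2; rewrite RRE r0 r1 r2 expr0n !addr0 ltxx.
have [c] := rank1_sgrad_H.
rewrite (sgrad_H beta0 dg1 dg2 dg3 dV HE RR0) !hvfE => e.
have := (congr1 (fun z => Rc z 0) e, congr1 (fun z => Rc z 1) e).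
rewrite !scE r0 r1 !(mul0r, mulr0, oppr0, addr0, add0r, subr0, sub0r).
move=> -[/eqP e0 /eqP e1].
move: e0 e1; rewrite ?oppr_eq0 !mulf_eq0 (negPf r2) !orbF => /eqP s1 /eqP s0.
have /negP := rank1_XK_neq0; apply; rewrite hvfE; apply/eqP.
by apply: E3P; rewrite !scE ?r0 ?r1 ?s0 ?s1; split; ring.
Qed.

(** X_K, X_x and X_J are independent where [rho] is nonzero. The third R-component only involves
    [eta], multiplied by [rho]; the other R-components then give [gam = c], and the first two
    S-components give [xi = 0]. *)
Lemma rank1_coefs : [/\ sgrad H y = gam beta g3 y *: hvf y (covK R),
  xi g1 g2 g3 V y = 0 & eta g1 y = 0].
Proof.
have r0 := rank1_rho_neq0.
have Hred := sgrad_H_reduced beta0 dg1 dg2 dg3 dV HE RR0 r0.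
suff [x0 e0] : xi g1 g2 g3 V y = 0 /\ eta g1 y = 0.
  by rewrite Hred x0 e0 !scale0r !addr0.
have [c] := rank1_sgrad_H; rewrite Hred.
move: (gam _ _ _) (xi _ _ _ _ _) (eta _ _) => a b d; rewrite !hvfE => e.
have := (congr1 (fun z => Rc z 0) e, congr1 (fun z => Rc z 1) e,
  congr1 (fun z => Rc z 2) e, congr1 (fun z => Sc z 0) e,
  congr1 (fun z => Sc z 1) e).
rewrite !scE => -[[[[e0 e1] e2] e3] e4].
have z0 (t : R) : t * Rc y 0 = 0 -> t * Rc y 1 = 0 -> t = 0.
  move=> t0 t1; apply: (mulIf r0); rewrite mul0r rhoE.
  by rewrite mulrDr !expr2 !mulrA t0 t1 !mul0r addr0.
have d0 : d = 0.
  apply: (mulIf r0); rewrite mul0r -(mulr0 c) rhoE.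
  transitivity (c * (0 * Rc y 1 - 0 * Rc y 0)); last by ring.
  by rewrite -e2; ring.
have sub0 (u v : R) : u = v -> v - u = 0 by move=> ->; rewrite subrr.
have ac : a - c = 0.
  by apply: z0; [rewrite -[RHS]oppr0 -(sub0 _ _ e1)|rewrite -(sub0 _ _ e0)];
    rewrite d0; ring.
split=> //; rewrite -(subrK c a) ac add0r d0 in e3 e4.
by apply: z0; [rewrite -[RHS]oppr0 -(sub0 _ _ e4)|rewrite -(sub0 _ _ e3)]; ring.
Qed.

End RankOne.

(** * Smooth extensions of the coefficients, square roots, and the conclusion *)

Lemma smooth_on_twice_diff (R : realType) (f : R * R -> R) :
  smooth_on (coef_dom R) f ->
  exists2 F, twice_diff F & forall p, coef_dom R p -> F p = f p.
Proof.
move=> [U [F [oU DU Ff dF]]]; exists F => [p /DU Up|p Dp].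
  have [dF1 dF2] := dF 2%N.
  by split; [exact: dF1|have [d _] := dF2 (1, 0)|have [d _] := dF2 (0, 1)]; exact: d.
by apply: Ff; rewrite inE.
Qed.

Lemma sqr_real_complexP (R : rcfType) (c : R) (l : R[i]) : 0 <= c ->
  l ^+ 2 = real_complex R c <->
  l = (Num.sqrt c +i* 0)%C \/ l = (- Num.sqrt c +i* 0)%C.
Proof.
move=> c0; have -> : real_complex R c = ((Num.sqrt c +i* 0)%C) ^+ 2.
  by rewrite -{1}(sqr_sqrtr c0) rmorphXn.
have -> : (- Num.sqrt c +i* 0)%C = - (Num.sqrt c +i* 0)%C by simpc.
split=> [/eqP|]; first by rewrite eqf_sqr => /orP[]/eqP; [left|right].
by case=> ->; rewrite ?sqrrN.
Qed.

Lemma sqr_real_complexNP (R : rcfType) (c : R) (l : R[i]) : 0 <= c ->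
  l ^+ 2 = real_complex R (- c) <->
  l = (0 +i* Num.sqrt c)%C \/ l = (0 +i* - Num.sqrt c)%C.
Proof.
move=> c0; have -> : real_complex R (- c) = ((0 +i* Num.sqrt c)%C) ^+ 2.
  by rewrite expr2 -{1}(sqr_sqrtr c0) expr2; simpc.
have -> : (0 +i* - Num.sqrt c)%C = - (0 +i* Num.sqrt c)%C by simpc.
split=> [/eqP|]; first by rewrite eqf_sqr => /orP[]/eqP; [left|right].
by case=> ->; rewrite ?sqrrN.
Qed.

Theorem theorem6 (R : realType) (beta : R) (g1 g2 g3 V : R * R -> R)
    (a g : R) (y : 'rV[R]_(3 + 3))
    (beta_gt0 : 0 < beta)
    (g1_smooth : smooth_on (coef_dom R) g1)
    (g2_smooth : smooth_on (coef_dom R) g2)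
    (g3_smooth : smooth_on (coef_dom R) g3)
    (V_smooth : smooth_on (coef_dom R) V)
    (a_gt0 : 0 < a)
    (y_leaf : leaf a g y)
    (y_rank1 : singular_rank1 (Ham beta g1 g2 g3 V) (Kint R) y) :
  let H := Ham beta g1 g2 g3 V in
  let K := Kint R in
  let k := Sc y 2 in
  let x := Rc y 2 in
  let Wxx := ((W beta g1 g2 g3 V a g k)^`(2))%classic x in
  [/\ x ^+ 2 < a,
      nondegenerate_point H K y <-> Wxx != 0,
      0 < Wxx -> elliptic_point H K y
    & Wxx < 0 -> hyperbolic_point H K y].
Proof.
move=> H K k x Wxx; have beta0 : beta != 0 by rewrite gt_eqF.
have [G1 dG1 G1E] := smooth_on_twice_diff g1_smooth.
have [G2 dG2 G2E] := smooth_on_twice_diff g2_smooth.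
have [G3 dG3 G3E] := smooth_on_twice_diff g3_smooth.
have [U dU UE] := smooth_on_twice_diff V_smooth.
(* The pair (R^2, R_3) lies in [coef_dom] whenever R is nonzero, so H is unchanged by the extension
   of its coefficients on an open set containing [y]. *)
have HE z : 0 < RR z -> Ham beta G1 G2 G3 U z = H z.
  move=> /coef_dom_base zD.
  by rewrite /H /Ham (G1E _ zD) (G2E _ zD) (G3E _ zD) (UE _ zD).
have [yRR ySR] := y_leaf.
have RR0 : 0 < RR y by rewrite yRR.
have rho0 := rank1_rho_neq0 beta0 dG1 dG2 dG3 dU HE RR0 y_rank1.
have XK0 := rank1_XK_neq0 beta0 dG1 dG2 dG3 dU HE RR0 y_rank1.
have LXK := rank1_orbit_span beta0 dG1 dG2 dG3 dU HE RR0 y_rank1.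
have [sgH xi0 eta0] := rank1_coefs beta0 dG1 dG2 dG3 dU HE RR0 y_rank1.
have rho_gt0 : 0 < rho y by rewrite lt_def rho0 rhoE addr_ge0 ?sqr_ge0.
have rhoa : rho y = a - x ^+ 2 by rewrite /rho yRR.
have xa : x ^+ 2 < a by rewrite -subr_gt0 -rhoa.
(* With h as the reduced function of x and J, this is the elimination formula h_xx - h_xJ^2 / h_JJ,
   where h_JJ = 1 / rho. It is checked on the explicit derivatives after inserting the critical
   value of J. *)
have WxxE : Wxx = xi_x G1 G2 G3 U y - rho y * eta_x G1 y ^+ 2.
  have WE t : t ^+ 2 < a -> W beta G1 G2 G3 U a g k t = W beta g1 g2 g3 V a g k t.
    move=> ta; have tD : coef_dom R (a, t) by split => //; exact: ltW.
    by rewrite /W (G1E _ tD) (G2E _ tD) (G3E _ tD) (UE _ tD).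
  rewrite /Wxx (derive2_W dG1 dG2 dG3 dU a_gt0 WE xa) -rhoa.
  have J0 : Jint y = - rho y * G1 (a, x).
    have /eqP := eta0; rewrite /eta /base yRR addrC addr_eq0 => /eqP e.
    by rewrite mulNr -mulrN -e mulrC divfK.
  rewrite /xi_x /eta_x /base J0 ySR yRR -/x -[Kint R y]/k.
  move: rho0; generalize (rho y) => r r0.
  move: (pd2 (pd2 G1) _) (pd2 (pd2 G2) _) (pd2 (pd2 G3) _) (pd2 (pd2 U) _)
    => h1 h2 h3 h4.
  move: (pd2 G1 _) (G1 _) => j1 j2; move: (k) (x) => k' x'.
  by field.
have sgK : sgrad K y = hvf y (covK R) by exact: sgrad_Kint.
have spec p q : p != 0 -> p * gam beta G3 y + q = 0 -> forall l,
    ceigenvalue (induced_mx H K (fun z => p * H z + q * K z) y) l <->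
    l ^+ 2 = real_complex R (- (p ^+ 2 * rho y * Wxx)).
  by move=> p0 pq l; rewrite WxxE; exact: (ceigenvalue_induced_mx beta0).
(* At [y] the field of H is [gam] times X_K, so H - gam K is critical there. *)
have vanish : vanishing_comb H K (fun z => 1 * H z + - gam beta G3 y * K z) y.
  exists 1, (- gam beta G3 y); split => //.
    by apply/eqP => -[/eqP]; rewrite oner_eq0.
  rewrite (sgrad_comb beta0 dG1 dG2 dG3 dU HE) // sgK sgH.
  by rewrite scale1r scaleNr subrr.
have spec1 l : ceigenvalue
      (induced_mx H K (fun z => 1 * H z + - gam beta G3 y * K z) y) l <->
    l ^+ 2 = real_complex R (- (rho y * Wxx)).
  have := spec 1 (- gam beta G3 y) (oner_neq0 _) _ l.
  by rewrite expr1n !mul1r; apply; rewrite subrr.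
split=> //.
(* Non-degeneracy supplies some unknown vanishing combination, so the direct implication must treat
   all of them: when [Wxx = 0], each has 0 as an eigenvalue. *)
- split=> [[F [p [q [pq0 -> sgF]]] nondeg]|W0].
    apply/eqP => W0; move: sgF.
    rewrite (sgrad_comb beta0 dG1 dG2 dG3 dU HE) // sgK sgH scalerA -scalerDl.
    move=> /eqP; rewrite scaler_eq0 (negPf XK0) orbF => /eqP pq.
    (* As X_K is nonzero, [p = 0] would entail [q = 0], against the non-triviality of the
       combination. *)
    have p0 : p != 0.
      by apply: contraNneq pq0 => p0; move: pq; rewrite p0 mul0r add0r => ->.
    have /nondeg : ceigenvalue (induced_mx H K (fun z => p * H z + q * K z) y) 0.
      by apply/spec => //; rewrite W0 mulr0 oppr0 expr0n rmorph0.
    by rewrite eqxx.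
  exists (fun z => 1 * H z + - gam beta G3 y * K z) => // l /spec1 l2.
  apply/eqP => l0; move/eqP: l2; rewrite l0 expr0n /= eq_sym fmorph_eq0.
  by rewrite oppr_eq0 mulf_eq0 (negPf rho0) (negPf W0).
- move=> W0; exists (fun z => 1 * H z + - gam beta G3 y * K z) => //.
  have rW : 0 < rho y * Wxx by rewrite mulr_gt0.
  (* The eigenvalues satisfy l^2 = - rho W'' with rho positive, so the sign of W'' decides between
     imaginary and real square roots. *)
  exists (Num.sqrt (rho y * Wxx)); first by rewrite gt_eqF // sqrtr_gt0.
  by move=> l; rewrite spec1; exact/sqr_real_complexNP/ltW.
- move=> W0; exists (fun z => 1 * H z + - gam beta G3 y * K z) => //.
  have rW : 0 < - (rho y * Wxx) by rewrite -mulrN mulr_gt0 // oppr_gt0.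
  exists (Num.sqrt (- (rho y * Wxx))); first by rewrite gt_eqF // sqrtr_gt0.
  by move=> l; rewrite spec1; exact/sqr_real_complexP/ltW.
Qed.
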